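(* Let $A\in\{1,\dots,k\}$ and define $\psi(P)=(\mathbb{E}_P(\mu_1(X)),\dots,\mathbb{E}_P(\mu_k(X)))\in\mathbb{R}^k$. Let $\mathcal{P}$ denote the set of distributions $P$ of $(X,A,Y)$ for which $\pi_a(x)\ge C'/k$ for all $a$, for a constant $C'>0$ (for which $\mathcal{P}$ is nonempty, i.e. $C'\le1$), $Y$ is binary ($Y\in\{0,1\}$), and $(A,Y)$ is independent of $X$. If $k\ge32$, then $$\inf_{\widehat\psi}\sup_{P\in\mathcal{P}}\mathbb{E}_P\left(\sum_{a=1}^k\varpi_a(P)\big(\widehat\psi_a-\psi_a(P)\big)^2\right)\ \ge\ C\min\left(\frac kn,\,1\right)$$ for $\varpi_a(P)=P(A=a)$ and $C>0$ a universal constant.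
   Context: $X\in\mathbb{R}^d$, $\mu_a(x)=\mathbb{E}_P(Y\mid X=x,A=a)$, $\pi_a(x)=P(A=a\mid X=x)$. The infimum is over all estimators $\widehat\psi=(\widehat\psi_1,\dots,\widehat\psi_k)$, i.e. measurable $\mathbb{R}^k$-valued functions of an i.i.d. sample of size $n$ from $P$, and $\mathbb{E}_P$ is expectation over that sample. *)

(* Defs.v *)
From HB Require Import structures.
From mathcomp Require Import all_boot all_order all_algebra.
From mathcomp Require Import all_classical all_reals all_analysis.
Set Implicit Arguments.
Unset Strict Implicit.
Unset Printing Implicit Defensive.
Import Order.TTheory GRing.Theory Num.Theory.
Import numFieldNormedType.Exports.

Local Open Scope classical_set_scope.
Local Open Scope ring_scope.

Section iid.
Context (disp : measure_display) (T : measurableType disp) (R : realType).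

Definition cons_pair (n : nat) (z : T * n.-tuple T) : n.+1.-tuple T :=
  [tuple of z.1 :: z.2].

Lemma measurable_cons_pair n : measurable_fun setT (@cons_pair n).
Proof. exact: measurable_cons. Qed.

HB.instance Definition _ n :=
  isMeasurableFun.Build _ _ _ _ (@cons_pair n) (@measurable_cons_pair n).

(* The product law P^n on n.-tuple T. *)
Fixpoint iid_law (P : probability T R) (n : nat) : probability (n.-tuple T) R :=
  if n is m.+1
  then distribution (P \x iid_law P m)%E (@cons_pair m)
  else dirac [tuple].

Lemma iid_lawE (P : probability T R) (n : nat) (B : 'I_n -> set T) :
  (forall i, measurable (B i)) ->
  iid_law P n [set s | forall i, B i (tnth s i)] = (\prod_(i < n) P (B i))%E.
Proof.
elim: n B => [|n IHn] B mB.
  rewrite big_ord0 /= diracE mem_set//; by case.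
have mBn : measurable [set s : n.-tuple T | forall i, B (lift ord0 i) (tnth s i)].
  rewrite (_ : [set _ | _] = \bigcap_(i in setT)
     ((fun s : n.-tuple T => tnth s i) @^-1` B (lift ord0 i))); last first.
    by apply/seteqP; split=> s /= h i; [move=> _; exact: h|exact: h].
  apply: fin_bigcap_measurable => [|i _]; first exact: finite_finset.
  rewrite -[X in measurable X]setTI; exact: measurable_tnth.
rewrite big_ord_recl /= /distribution /pushforward.
rewrite -IHn// -product_measure1E//; congr (_ _).
apply/seteqP; split=> -[x s] /=.
  move=> h; split; first by have := h ord0; rewrite tnth0.
  by move=> i; have := h (lift ord0 i); rewrite tnthS.
move=> [h0 h] i; case: (unliftP ord0 i) => [j ->|->].
  by rewrite tnthS.
by rewrite tnth0.
Qed.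

End iid.

Section conditional_expectation.
Context (d1 d2 : measure_display) (T : measurableType d1)
  (T' : measurableType d2) (R : realType).
Variables (P : probability T R) (W : T -> T') (f : T -> R).

(* g is a version of w |-> E_P(f | W = w). *)
Definition is_cond_exp (g : T' -> R) : Prop :=
  [/\ measurable_fun setT g,
      P.-integrable setT (EFin \o (g \o W)) &
      forall D : set T', measurable D ->
        (\int[P]_(z in W @^-1` D) (g (W z))%:E =
         \int[P]_(z in W @^-1` D) (f z)%:E)%E].

(* An arbitrary version: one exists when f is integrable, and any two agree
   almost everywhere for the law of W. *)
Definition cond_exp : T' -> R := xget (fun=> 0) is_cond_exp.

End conditional_expectation.

Section model.
Context (R : realType) (d : nat).

(* An observation (X, A, Y). The sigma-algebra on d.-tuple R is generated by the
   coordinates, i.e. the Borel one of R^d; the supports {1, ..., k} of A and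
   {0, 1} of Y are imposed on the law P in model_class. *)
Definition obs := (d.-tuple (measurableTypeR R) * nat * measurableTypeR R)%type.

Definition covariate (z : obs) : d.-tuple (measurableTypeR R) := z.1.1.
Definition treatment (z : obs) : nat := z.1.2.
Definition outcome (z : obs) : R := z.2.

Variable P : probability obs R.

(* mu_a(x) = E_P(Y | X = x, A = a) *)
Definition mu (a : nat) (x : d.-tuple (measurableTypeR R)) : R :=
  cond_exp P (fun z => (covariate z, treatment z)) outcome (x, a).

(* pi_a(x) = P(A = a | X = x) *)
Definition propensity (a : nat) : d.-tuple (measurableTypeR R) -> R :=
  cond_exp P covariate (fun z => (treatment z == a)%:R).

Definition varpi (a : nat) : R := fine (P [set z | treatment z = a]).

(* The choice of version of mu_a is immaterial when pi_a > 0 a.s., since the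
   law of X is then dominated by P(X \in _, A = a). *)
Definition psi (a : nat) : R := fine ('E_P[mu a \o covariate]).

Definition AY_indep_X : Prop :=
  forall (B : set (d.-tuple (measurableTypeR R)))
         (D : set (nat * measurableTypeR R)),
    measurable B -> measurable D ->
    (P [set z | B (covariate z) /\ D (treatment z, outcome z)] =
     P [set z | B (covariate z)] *
     P [set z | D (treatment z, outcome z)])%E.

End model.

Definition model_class (R : realType) (d k : nat) (C' : R) :
    set (probability (obs R d) R) :=
  [set P : probability (obs R d) R |
   [/\ {ae P, forall z, (1 <= treatment z <= k)%N},
       {ae P, forall z, outcome z = 0 \/ outcome z = 1},
       forall a : nat, (1 <= a <= k)%N ->
         {ae P, forall z, C' / k%:R <= propensity P a (covariate z)} &
       AY_indep_X P]].
Arguments model_class {R} d k C'.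

(* The i-th coordinate of an estimate (i < k) refers to treatment level i.+1. *)
Definition risk (R : realType) (d k n : nat)
    (psihat : n.-tuple (obs R d) -> k.-tuple (measurableTypeR R))
    (P : probability (obs R d) R) : \bar R :=
  ('E_(iid_law P n)[fun s =>
     (\sum_(i < k) varpi P i.+1 * (tnth (psihat s) i - psi P i.+1) ^+ 2)%R])%E.

Definition minimax_risk (R : realType) (d k n : nat) (C' : R) : \bar R :=
  ereal_inf [set ereal_sup [set risk psihat P | P in model_class d k C'] |
    psihat in [set f : n.-tuple (obs R d) -> k.-tuple (measurableTypeR R) |
                 measurable_fun setT f]].

(* Main.v *)
From HB Require Import structures.
Require Import Defs.
From mathcomp Require Import all_boot all_order all_algebra.
From mathcomp Require Import all_classical all_reals all_analysis.
From mathcomp Require Import measurable_realfun ring lra.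
Import Order.TTheory GRing.Theory Num.Theory.
Import numFieldNormedType.Exports.
Local Open Scope classical_set_scope.
Local Open Scope ring_scope.

(** Why the bound holds. Inside the model class sits a hypercube of very simple
laws: X is constant, A is uniform on {1, ..., k}, and given A = i the outcome
is Bernoulli with success probability 1/2 + delta or 1/2 - delta according to
a bit v_i. For these laws varpi_i = 1/k, psi_i is that success probability
([psi_cube]), and membership in the class holds because the propensity is 1/k
and X carries no information ([cube_law_model]).

Flipping one bit v_i alters the law only on the event A = i, of probability
1/k, and there only at order delta^2 in squared Hellinger distance. The
Hellinger affinity of the two laws is therefore at least 1 - 4 delta^2 / k
([affinity_flip]); as affinities multiply over independent observations
([affinity_prod]), the affinity of the two samples stays at least 1/2 as long as
4 n delta^2 / k <= 1/2 ([affinity_sample_flip]). Two laws with affinity rho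
and targets a, b force any estimator to have total squared error at least
(a - b)^2 rho^2 / 2 ([two_point_bound]), here delta^2 / 2. Averaging over all
v, paired along each of the k coordinates, gives Assouad's bound: some vertex
v has risk at least delta^2 / 4 ([assouad_risk]). The choice
delta^2 = min(k / n, 1) / 8 is admissible and yields the constant 1/32.

The hypercube laws have finitely many atoms, so all of their integrals,
including expectations over the sample, become finite sums
([ge0_integral_mixture], [ge0_integral_iid_mixture]), and the statistical
argument is carried out on those sums. *)

Set Implicit Arguments.
Unset Strict Implicit.
Unset Printing Implicit Defensive.

(** * Laws with finitely many atoms *)

Record finpmf (R : realType) (I : finType) := FinPmf {
  finpmf_val :> I -> {nonneg R};
  finpmf_sum1 : \sum_i (finpmf_val i)%:num = 1 }.

Lemma sum_enum_val (R : realType) (I : finType) (F : I -> \bar R) :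
  (\sum_(j < #|I|) F (enum_val j) = \sum_i F i)%E.
Proof. by rewrite -(big_enum_val (A := I)). Qed.

Section mixture.
Context (R : realType) (I : finType) (disp : measure_display)
  (T : measurableType disp).
Implicit Types (p : finpmf R I) (x : I -> T).

(** The measures summed by [msum] are indexed by nat, so the atoms are numbered
by [enum_val] and the sequence is completed by the zero measure. *)
Definition mixture_part p x (j : nat) : {measure set T -> \bar R} :=
  if insub j is Some j' then mscale (p (enum_val (j' : 'I_#|I|))) \d_(x (enum_val j'))
  else mzero.

Definition mixture p x : set T -> \bar R := msum (mixture_part p x) #|I|.

HB.instance Definition _ p x := Measure.on (mixture p x).

Lemma mixtureE p x (A : set T) :
  mixture p x A = (\sum_i (p i)%:num%:E * \d_(x i) A)%E.
Proof.
rewrite /mixture /msum -[RHS]sum_enum_val.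
by apply: eq_bigr => j _; rewrite /mixture_part valK.
Qed.

Lemma mixture_setT p x : mixture p x setT = 1%E.
Proof.
rewrite mixtureE; under eq_bigr do rewrite diracT mule1.
by rewrite sumEFin finpmf_sum1.
Qed.

HB.instance Definition _ p x :=
  Measure_isProbability.Build _ _ _ (mixture p x) (mixture_setT p x).

Lemma fine_mixture p x (A : set T) :
  fine (mixture p x A) = \sum_i (p i)%:num * \1_A (x i).
Proof.
rewrite mixtureE; under eq_bigr do rewrite diracE -EFinM.
by rewrite sumEFin; under eq_bigr do rewrite -indicE.
Qed.

Lemma ge0_integral_mixture p x (D : set T) (f : T -> \bar R) :
  measurable D -> measurable_fun D f -> (forall t, D t -> (0 <= f t)%E) ->
  (\int[mixture p x]_(t in D) f t = \sum_i (p i)%:num%:E * (\d_(x i) D * f (x i)))%E.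
Proof.
move=> mD mf f0; rewrite ge0_integral_measure_sum// -[RHS]sum_enum_val.
apply: eq_bigr => j _; rewrite /mixture_part valK.
by rewrite ge0_integral_mscale// integral_dirac.
Qed.

(** Integrals of signed functions are differences of integrals of positive and
negative parts; both are finite sums of reals here, so their difference is
never of the form oo - oo. *)
Lemma integral_mixture p x (D : set T) (f : T -> R) :
  measurable D -> measurable_fun setT f ->
  (\int[mixture p x]_(t in D) (f t)%:E =
   (\sum_i (p i)%:num * (\1_D (x i) * f (x i)))%:E)%E.
Proof.
move=> mD mf.
have mfD : measurable_fun D (EFin \o f).
  by apply/measurable_EFinP; exact: measurable_funTS.
rewrite integralE !ge0_integral_mixture//; last 2 first.
  exact: (measurable_funeneg mfD).
  exact: (measurable_funepos mfD).
transitivity ((\sum_i ((p i)%:num * (\1_D (x i) * Num.max (f (x i)) 0))%:E) -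
   \sum_i ((p i)%:num * (\1_D (x i) * Num.max (- f (x i)) 0))%:E)%E.
  by congr (_ - _)%E; apply: eq_bigr => i _;
    rewrite ?funeposE ?funenegE diracE indicE !EFinM EFin_max.
rewrite !sumEFin -EFinB -sumrB; congr EFin; apply: eq_bigr => i _.
rewrite -!mulrBr; congr (_ * (_ * _)).
by case: (leP 0 (f (x i))) => ?; case: (leP 0 (- f (x i))) => ?; lra.
Qed.

Lemma integrable_mixture p x (f : T -> R) :
  measurable_fun setT f -> (mixture p x).-integrable setT (EFin \o f).
Proof.
move=> mf; apply/integrableP; split; first exact/measurable_EFinP.
have := integral_mixture p x measurableT (measurableT_comp (@normr_measurable R setT) mf).
by move=> /= ->; exact: ltry.
Qed.

(** Measurability of the property replaces measurability of the singletons: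
the exceptional set is then itself a measurable null set. *)
Lemma ae_mixture p x (Q : T -> Prop) :
  measurable [set t | Q t] -> (forall i, Q (x i)) -> {ae mixture p x, forall t, Q t}.
Proof.
move=> mQ Qx; exists (~` [set t | Q t]); split => //; first exact: measurableC.
rewrite [LHS]mixtureE big1// => i _; rewrite diracE memNset ?mule0//.
by move=> /(_ (Qx i)).
Qed.

End mixture.

(** * Samples from a law with finitely many atoms *)

Lemma sum_tuple0 (V : nmodType) (I : finType) (F : 0.-tuple I -> V) :
  \sum_s F s = F [tuple].
Proof. by rewrite (big_pred1 [tuple])// => s; rewrite [s]tuple0; apply/esym/eqP. Qed.

Lemma sum_tuple_cons (V : nmodType) (I : finType) (n : nat)
    (F : n.+1.-tuple I -> V) :
  \sum_s F s = \sum_i \sum_(s : n.-tuple I) F [tuple of i :: s].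
Proof.
rewrite pair_bigA /= (reindex (fun u : I * n.-tuple I => [tuple of u.1 :: u.2]))//=.
exists (fun s : n.+1.-tuple I => (thead s, [tuple of behead s])) => [[i s] _|s _] /=.
  by rewrite theadE; congr pair; apply: val_inj.
by rewrite [RHS]tuple_eta; apply: val_inj.
Qed.

Lemma prod_tnth_cons (V : comPzSemiRingType) (I : finType) (n : nat) (F : I -> V)
    (i : I) (s : n.-tuple I) :
  \prod_(j < n.+1) F (tnth [tuple of i :: s] j) = F i * \prod_(j < n) F (tnth s j).
Proof.
by rewrite big_ord_recl tnth0; congr (_ * _); apply: eq_bigr => j _; rewrite tnthS.
Qed.

(** An i.i.d. sample from a finite mixture is again a finite mixture, over the
tuples of labels with product weights. Tonelli peels off one observation at a
time, following the recursion that defines the product law. *)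
Lemma ge0_integral_iid_mixture (R : realType) (I : finType) (disp : measure_display)
    (T : measurableType disp) (p : finpmf R I) (x : I -> T) (n : nat)
    (g : n.-tuple T -> \bar R) :
  measurable_fun setT g -> (forall t, (0 <= g t)%E) ->
  (\int[iid_law (mixture p x) n]_t g t =
   \sum_(s : n.-tuple I) (\prod_(j < n) (p (tnth s j))%:num)%:E
     * g [tuple of map x s])%E.
Proof.
elim: n g => [|n IHn] g mg g0.
  rewrite /= integral_dirac// diracT mul1e sum_tuple0 big_ord0 mul1e.
  by congr g; apply: val_inj.
have mgc : measurable_fun setT (g \o @cons_pair _ T n).
  exact: (measurableT_comp mg (@measurable_cons_pair _ T n)).
rewrite /= (ge0_integral_pushforward (@measurable_cons_pair _ T n))//.
rewrite preimage_setT (fubini_tonelli1 _ mgc); last by move=> z; exact: g0.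
rewrite ge0_integral_mixture//; last 2 first.
  by apply: (measurable_fun_fubini_tonelli_F _ mgc) => z; exact: g0.
  by move=> t _; apply: integral_ge0 => u _; exact: g0.
rewrite sum_tuple_cons; apply: eq_bigr => i _.
rewrite diracT mul1e /fubini_F /= IHn//; last first.
  exact: (measurableT_comp mgc (@pair1_measurable _ _ _ _ (x i))).
rewrite ge0_sume_distrr; last first.
  by move=> s _; rewrite mule_ge0// lee_fin; apply: prodr_ge0.
apply: eq_bigr => s _.
rewrite (prod_tnth_cons (fun i => (p i)%:num)) EFinM muleA; congr (_ * g _)%E.
by apply: val_inj.
Qed.

(** * Hellinger affinity and two-point bounds *)

Lemma sum_prod_tnth (V : comPzSemiRingType) (I : finType) (F : I -> V) (n : nat) :
  \sum_(s : n.-tuple I) \prod_(j < n) F (tnth s j) = (\sum_i F i) ^+ n.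
Proof.
elim: n => [|n IHn]; first by rewrite sum_tuple0 big_ord0.
rewrite sum_tuple_cons exprS mulr_suml; apply: eq_bigr => i _.
by rewrite -IHn mulr_sumr; apply: eq_bigr => s _; rewrite prod_tnth_cons.
Qed.

Lemma sqrtr_prod (R : rcfType) (I : finType) (F : I -> R) :
  (forall i, 0 <= F i) -> Num.sqrt (\prod_i F i) = \prod_i Num.sqrt (F i).
Proof.
move=> F0; suff [] : Num.sqrt (\prod_i F i) = \prod_i Num.sqrt (F i) /\
  0 <= \prod_i F i by [].
elim/big_rec2: _ => [|i y1 y2 _ [<- y20]]; first by rewrite sqrtr1.
by rewrite sqrtrM// mulr_ge0.
Qed.

Lemma bernoulli_ineq (R : realDomainType) (x : R) (n : nat) :
  0 <= x <= 1 -> 1 - n%:R * x <= (1 - x) ^+ n.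
Proof.
move=> /andP[x0 x1]; elim: n => [|n IHn]; first by rewrite mul0r subr0.
rewrite exprS; apply: (le_trans _ (ler_wpM2l _ IHn)); last by rewrite subr_ge0.
have : 0 <= n%:R * x * x by rewrite !mulr_ge0.
by rewrite -natr1; lra.
Qed.

Section hellinger.
Context (R : rcfType) (S : finType).
Implicit Types P Q : S -> R.

Definition affinity P Q : R := \sum_s Num.sqrt (P s * Q s).

(** Le Cam's two-point bound in Hellinger form. Write a - b as the difference
of the two errors f - b and f - a, weigh it by sqrt (P s) sqrt (Q s), and
absorb each product into a squared error under P or Q by completing a square
with parameter t. *)
Lemma two_point_bound P Q (f : S -> R) (a b : R) :
  (forall s, 0 <= P s) -> (forall s, 0 <= Q s) ->
  \sum_s P s = 1 -> \sum_s Q s = 1 ->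
  (a - b) ^+ 2 * affinity P Q ^+ 2 <=
  2 * (\sum_s P s * (f s - a) ^+ 2 + \sum_s Q s * (f s - b) ^+ 2).
Proof.
move=> P0 Q0 P1 Q1; set rho := affinity P Q.
(* The value of t that optimises the bound proved next. *)
pose t := (a - b) * rho / 2.
suff : 2 * t * (a - b) * rho <= (\sum_s P s * (f s - a) ^+ 2 +
    \sum_s Q s * (f s - b) ^+ 2) + t ^+ 2 * (\sum_s P s + \sum_s Q s).
  rewrite P1 Q1 /t; move: (\sum_s _ + _) => AB; lra.
rewrite /rho /affinity (mulrDr (t ^+ 2)) !mulr_sumr -!big_split /=.
apply: ler_sum => s _; rewrite sqrtrM//.
rewrite -{2 3}[P s]sqr_sqrtr// -{2 3}[Q s]sqr_sqrtr//.
set u := Num.sqrt (P s); set v := Num.sqrt (Q s).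
have h1 := sqr_ge0 (v * (f s - b) - t * u).
have h2 := sqr_ge0 (u * (f s - a) + t * v).
lra.
Qed.

End hellinger.

(** Affinities multiply over independent observations; this is what makes the
Hellinger affinity preferable to total variation here. *)
Lemma affinity_prod (R : rcfType) (I : finType) (p q : I -> R) (n : nat) :
  (forall i, 0 <= p i) -> (forall i, 0 <= q i) ->
  affinity (fun s : n.-tuple I => \prod_(j < n) p (tnth s j))
           (fun s => \prod_(j < n) q (tnth s j)) = affinity p q ^+ n.
Proof.
move=> p0 q0; rewrite /affinity -sum_prod_tnth; apply: eq_bigr => s _.
by rewrite -big_split sqrtr_prod// => j; apply: mulr_ge0.
Qed.

(** * Assouad's argument on the hypercube of success probabilities *)

Section hypercube.
Context (R : realType) (k : nat) (delta : R).
Implicit Types (v : {ffun 'I_k -> bool}) (z : 'I_k * bool).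

Definition success v (i : 'I_k) : R := 2^-1 + (if v i then delta else - delta).

(** The joint law of (A, Y), with treatment level a encoded as the ordinal
a - 1 and the binary outcome as a boolean. *)
Definition cell_weight v z : R :=
  k%:R^-1 * (if z.2 then success v z.1 else 1 - success v z.1).

Definition flip (i : 'I_k) v : {ffun 'I_k -> bool} :=
  [ffun j => if j == i then ~~ v j else v j].

Lemma flipK i : involutive (flip i).
Proof.
by move=> v; apply/ffunP => j; rewrite !ffunE; case: eqP => //; rewrite negbK.
Qed.

Lemma success_flip i v :
  (success v i - success (flip i v) i) ^+ 2 = 4 * delta ^+ 2.
Proof. by rewrite /success ffunE eqxx; case: (v i) => /=; field. Qed.

Context (k_gt0 : (0 < k)%N) (delta_ge0 : 0 <= delta) (delta_le : delta <= 2^-1).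

Let k_neq0 : k%:R != 0 :> R. Proof. by rewrite pnatr_eq0 -lt0n. Qed.

Let delta2_le : 4 * delta ^+ 2 <= 1.
Proof.
have h : 0 <= 2^-1 - delta by rewrite subr_ge0.
have := mulr_ge0 delta_ge0 h; lra.
Qed.

Lemma sum_cells (F : 'I_k * bool -> R) :
  \sum_z F z = \sum_i (F (i, true) + F (i, false)).
Proof.
transitivity (\sum_i \sum_b F (i, b)); last first.
  by apply: eq_bigr => i _; rewrite big_bool.
by rewrite pair_bigA; apply: eq_bigr => -[].
Qed.

Lemma cell_weight_ge0 v z : 0 <= cell_weight v z.
Proof.
rewrite mulr_ge0 ?invr_ge0//; move: delta_ge0 delta_le; rewrite /success.
by case: (z.2); case: (v z.1) => ? ?; lra.
Qed.

Lemma cell_weight_sum1 v : \sum_z cell_weight v z = 1.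
Proof.
rewrite sum_cells (eq_bigr (fun=> k%:R^-1)) => [|i _].
  by rewrite sumr_const card_ord -[RHS](mulVf k_neq0) mulr_natr.
by rewrite /cell_weight /= -mulrDr addrC subrK mulr1.
Qed.

(** The k - 1 levels at which the two laws agree contribute 1/k each; at level i each
outcome contributes sqrt (1/4 - delta^2) / k, and
sqrt (1/4 - delta^2) >= 1/2 - 2 delta^2. *)
Lemma affinity_flip i v :
  1 - 4 * delta ^+ 2 / k%:R <= affinity (cell_weight v) (cell_weight (flip i v)).
Proof.
have k0 : 0 < k%:R^-1 :> R by rewrite invr_gt0 ltr0n.
have d4 : 0 <= 1 - 4 * delta ^+ 2 by rewrite subr_ge0.
rewrite /affinity sum_cells (bigD1 i)//=.
rewrite [X in _ <= _ + X](eq_bigr (fun=> k%:R^-1)) => [|j ji]; last first.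
  rewrite /cell_weight /success /= ffunE (negbTE ji) -!expr2 !sqrtr_sqr.
  rewrite -[X in X + _]/(`|cell_weight v (j, true)|).
  rewrite -[X in _ + X]/(`|cell_weight v (j, false)|).
  rewrite !ger0_norm ?cell_weight_ge0// /cell_weight /success /= -mulrDr.
  by rewrite addrC subrK mulr1.
rewrite sumr_const cardC1 card_ord.
have -> : k%:R^-1 *+ k.-1 = 1 - k%:R^-1 :> R.
  by rewrite -[_ *+ k.-1]mulr_natr -subn1 natrB// mulrBr mulVf// mulr1.
have bound x : x = k%:R^-1 ^+ 2 * (4^-1 - delta ^+ 2) ->
    k%:R^-1 * (2^-1 - 2 * delta ^+ 2) <= Num.sqrt x.
  move=> ->; rewrite sqrtrM ?sqr_ge0// sqrtr_sqr gtr0_norm//.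
  rewrite ler_pM2l// -[leLHS]ger0_norm; last by lra.
  rewrite -sqrtr_sqr; apply: ler_wsqrtr.
  have := mulr_ge0 (sqr_ge0 delta) d4; lra.
have h y : k%:R^-1 * (2^-1 - 2 * delta ^+ 2) <=
  Num.sqrt (cell_weight v (i, y) * cell_weight (flip i v) (i, y)).
  apply: bound; rewrite /cell_weight /success /= ffunE eqxx.
  by case: y; case: (v i) => /=; field.
have := h true; have := h false; lra.
Qed.

Definition sample_weight v n (s : n.-tuple ('I_k * bool)) : R :=
  \prod_(j < n) cell_weight v (tnth s j).

Section sample.
Context (n : nat) (small_signal : n%:R * (4 * delta ^+ 2 / k%:R) <= 2^-1).

(** Bernoulli's inequality turns the smallness of n times the one-observation
defect into a bound free of n, k and delta. *)
Lemma affinity_sample_flip i v :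
  2^-1 <= affinity (@sample_weight v n) (@sample_weight (flip i v) n).
Proof.
have k1 : 1 <= k%:R :> R by rewrite ler1n.
have x01 : 0 <= 4 * delta ^+ 2 / k%:R <= 1.
  rewrite divr_ge0 ?mulr_ge0 ?sqr_ge0//= ler_pdivrMr ?ltr0n// mul1r.
  exact: le_trans delta2_le k1.
rewrite affinity_prod; [|exact: cell_weight_ge0..].
have h := bernoulli_ineq n x01.
apply: (@le_trans _ _ ((1 - 4 * delta ^+ 2 / k%:R) ^+ n)).
  by apply: le_trans h; move: small_signal; set y := _ * _; lra.
apply: lerXn2r; last exact: affinity_flip.
  by rewrite nnegrE subr_ge0; case/andP: x01.
by rewrite nnegrE; apply: sumr_ge0 => z _; exact: sqrtr_ge0.
Qed.

Lemma flip_pair_risk (f : n.-tuple ('I_k * bool) -> R) i v :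
  delta ^+ 2 / 2 <=
  \sum_s sample_weight v s * (f s - success v i) ^+ 2 +
  \sum_s sample_weight (flip i v) s * (f s - success (flip i v) i) ^+ 2.
Proof.
have W0 u s : 0 <= @sample_weight u n s.
  by apply: prodr_ge0 => j _; exact: cell_weight_ge0.
have W1 u : \sum_s @sample_weight u n s = 1.
  by rewrite sum_prod_tnth cell_weight_sum1 expr1n.
have := two_point_bound f (success v i) (success (flip i v) i)
  (W0 v) (W0 (flip i v)) (W1 v) (W1 (flip i v)).
rewrite success_flip => h.
have r2 := affinity_sample_flip i v.
have r4 : 4^-1 <= affinity (@sample_weight v n) (@sample_weight (flip i v) n) ^+ 2.
  move: r2; set r := affinity _ _ => r2; have := sqr_ge0 (r - 2^-1); lra.
have := mulr_ge0 (sqr_ge0 delta) (_ : 0 <= affinity (@sample_weight v n)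
  (@sample_weight (flip i v) n) ^+ 2 - 4^-1).
by rewrite subr_ge0 => /(_ r4); lra.
Qed.

(** Averaging over the hypercube decouples the coordinates: for each i the
vertices pair up along the involution [flip i], and every pair pays at least
delta^2 / 2. As the average risk is at least delta^2 / 4, so is some risk. *)
Lemma assouad_risk (f : n.-tuple ('I_k * bool) -> 'I_k -> R) :
  exists v, delta ^+ 2 / 4 <=
    \sum_s sample_weight v s * \sum_i k%:R^-1 * (f s i - success v i) ^+ 2.
Proof.
pose L i v := \sum_s sample_weight v s * (f s i - success v i) ^+ 2.
have coord i : \sum_(v : {ffun 'I_k -> bool}) delta ^+ 2 / 4 <= \sum_v L i v.
  have flipE : \sum_v L i (flip i v) = \sum_v L i v.
    by rewrite [RHS](reindex_inj (inv_inj (flipK i))).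
  have : \sum_(v : {ffun 'I_k -> bool}) delta ^+ 2 / 2 <=
         \sum_v (L i v + L i (flip i v)).
    by apply: ler_sum => v _; exact: flip_pair_risk.
  rewrite big_split /= flipE -!mulr_suml; lra.
apply/not_existsP => /= no_v.
have : \sum_v \sum_s sample_weight v s *
    (\sum_i k%:R^-1 * (f s i - success v i) ^+ 2) <
    \sum_(v : {ffun 'I_k -> bool}) delta ^+ 2 / 4.
  apply: ltr_sum => [|v _]; first by apply/hasP; exists [ffun=> true].
  by rewrite ltNge; apply/negP; exact: no_v.
apply/negP; rewrite -leNgt.
rewrite [leRHS](eq_bigr (fun v => \sum_i k%:R^-1 * L i v)) => [|v _]; last first.
  under eq_bigr do rewrite mulr_sumr.
  rewrite exchange_big /=; apply: eq_bigr => i _; rewrite mulr_sumr.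
  by apply: eq_bigr => s _; rewrite mulrCA.
rewrite [leRHS]exchange_big /=.
apply: (@le_trans _ _ (\sum_(i < k) k%:R^-1 *
    \sum_(v : {ffun 'I_k -> bool}) delta ^+ 2 / 4)).
  by rewrite [leRHS]sumr_const card_ord -mulrnAl -[_ *+ k]mulr_natr mulVf// mul1r.
apply: ler_sum => i _; by rewrite -[leRHS]mulr_sumr ler_wpM2l ?invr_ge0//.
Qed.

End sample.
End hypercube.

(** * Conditional expectations under finite mixtures *)

Lemma cond_exp_version (d1 d2 : measure_display) (T : measurableType d1)
    (T' : measurableType d2) (R : realType) (P : probability T R)
    (W : T -> T') (f : T -> R) (g : T' -> R) :
  is_cond_exp P W f g -> is_cond_exp P W f (cond_exp P W f).
Proof. by move=> h; apply: xgetPex; exists g. Qed.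

(** Testing on all measurable D, rather than on the fibres of W, avoids having
to know that the points of T' are measurable. *)
Lemma is_cond_exp_mixture (R : realType) (I : finType) (d1 d2 : measure_display)
    (T : measurableType d1) (T' : measurableType d2) (p : finpmf R I) (x : I -> T)
    (W : T -> T') (f : T -> R) (g : T' -> R) :
  measurable_fun setT W -> measurable_fun setT f ->
  is_cond_exp (mixture p x) W f g <->
  measurable_fun setT g /\ forall D : set T', measurable D ->
    \sum_i (p i)%:num * (\1_D (W (x i)) * g (W (x i))) =
    \sum_i (p i)%:num * (\1_D (W (x i)) * f (x i)).
Proof.
move=> mW mf.
have mWD D : measurable D -> measurable (W @^-1` D).
  by move=> mD; rewrite -[W @^-1` D]setTI; exact: mW.
split=> [[mg _ gf]|[mg gf]]; split => //.
- move=> D mD; have := gf D mD.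
  rewrite (integral_mixture _ _ (mWD _ mD) (measurableT_comp mg mW)).
  by rewrite (integral_mixture _ _ (mWD _ mD) mf) => -[].
- by apply: integrable_mixture; exact: measurableT_comp.
- move=> D mD; rewrite (integral_mixture _ _ (mWD _ mD) (measurableT_comp mg mW)).
  by rewrite (integral_mixture _ _ (mWD _ mD) mf); congr EFin; exact: gf.
Qed.

(** * The hypercube inside the model class *)

Section projections.
Context (R : realType) (d : nat).

Lemma measurable_covariate : measurable_fun setT (@covariate R d).
Proof. exact: measurableT_comp measurable_fst measurable_fst. Qed.

Lemma measurable_treatment : measurable_fun setT (@treatment R d).
Proof. exact: measurableT_comp measurable_snd measurable_fst. Qed.

Lemma measurable_outcome : measurable_fun setT (@outcome R d).
Proof. exact: measurable_snd. Qed.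

End projections.

Lemma measurable_fun_nat (R : realType) (h : nat -> R) : measurable_fun setT h.
Proof. by []. Qed.

Section hypercube_law.
Context (R : realType) (d k : nat) (delta : R).
Context (k_gt0 : (0 < k)%N) (delta_ge0 : 0 <= delta) (delta_le : delta <= 2^-1).
Implicit Type v : {ffun 'I_k -> bool}.

Definition cell_pmf v : finpmf R ('I_k * bool)%type :=
  FinPmf (finpmf_val := fun z => NngNum (cell_weight_ge0 delta_ge0 delta_le v z))
    (cell_weight_sum1 delta k_gt0 v).

Definition origin : d.-tuple (measurableTypeR R) := [tuple 0 | _ < d].

Definition atom (z : 'I_k * bool) : obs R d := (origin, z.1.+1, z.2%:R).

Definition cube_law v : probability (obs R d) R := mixture (cell_pmf v) atom.

Lemma sum_level v (i : 'I_k) (F : bool -> R) :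
  \sum_z (cell_pmf v z)%:num * ((z.1.+1 == i.+1)%:R * F z.2) =
  k%:R^-1 * (success delta v i * F true + (1 - success delta v i) * F false).
Proof.
rewrite sum_cells (bigD1 i)//= big1 ?addr0 => [|j ji]; last first.
  by rewrite eqSS (negbTE (ji : (j != i :> nat))) !mul0r !mulr0 addr0.
by rewrite eqxx !mul1r /cell_weight /= -!mulrA -mulrDr.
Qed.


Lemma sum_cell_pmf v : \sum_z (cell_pmf v z)%:num = 1.
Proof. exact: finpmf_sum1. Qed.

Lemma cube_lawE v (A : set (obs R d)) :
  (cube_law v A = \sum_z ((cell_pmf v z)%:num)%:E * \d_(atom z) A)%E.
Proof. exact: mixtureE. Qed.

Lemma mean_cst v (c : R) : \sum_z (cell_pmf v z)%:num * c = c.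
Proof. by rewrite -mulr_suml sum_cell_pmf mul1r. Qed.

(** A version exists, namely the constant 1/k, so the arbitrarily chosen
[propensity] is one too. *)
Lemma cond_exp_propensity v (i : 'I_k) :
  is_cond_exp (cube_law v) (@covariate R d) (fun z => (treatment z == i.+1)%:R)
    (propensity (cube_law v) i.+1).
Proof.
apply: (@cond_exp_version _ _ _ _ _ _ _ _ (cst k%:R^-1)).
apply/is_cond_exp_mixture.
- exact: measurable_covariate.
- exact: measurableT_comp (measurable_fun_nat (fun a => (a == i.+1)%:R))
    (@measurable_treatment R d).
split => // D mD; transitivity (\1_D origin * k%:R^-1 : R).
  exact: (mean_cst v (\1_D origin * k%:R^-1)).
rewrite [RHS](eq_bigr (fun z => (cell_pmf v z)%:num *
    ((z.1.+1 == i.+1)%:R * \1_D origin))) => [|z _]; last first.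
  by rewrite /= [X in _ * X]mulrC.
by rewrite (sum_level v i (fun=> \1_D origin)) -mulrDl addrC subrK mul1r mulrC.
Qed.

(** X has an atom at the origin, so every version of the propensity is forced to
the same value there. *)
Lemma propensity_cube v (i : 'I_k) :
  propensity (cube_law v) i.+1 origin = k%:R^-1.
Proof.
have /is_cond_exp_mixture[||_ /(_ setT measurableT)] := cond_exp_propensity v i.
- exact: measurable_covariate.
- exact: measurableT_comp (measurable_fun_nat (fun a => (a == i.+1)%:R))
    (@measurable_treatment R d).
under eq_bigr do rewrite indicT mul1r.
rewrite (mean_cst v (propensity _ _ origin)) => ->.
under eq_bigr do rewrite indicT mul1r -[(treatment _ == _)%:R]mulr1.
by rewrite (sum_level v i (fun=> 1)) !mulr1 addrC subrK mulr1.
Qed.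

(** The explicit version of mu; the value 0 off {1, ..., k} is a default on a
null set, and so is the value at treatment 0, which is sent to level 1. *)
Definition success_fun v (xa : d.-tuple (measurableTypeR R) * nat) : R :=
  if insub xa.2.-1 is Some i then success delta v i else 0.

Lemma measurable_covariate_treatment :
  measurable_fun setT (fun z : obs R d => (covariate z, treatment z)).
Proof.
apply: measurable_fun_pair; first exact: measurable_covariate.
exact: measurable_treatment.
Qed.

Lemma cond_exp_mu v :
  is_cond_exp (cube_law v) (fun z : obs R d => (covariate z, treatment z))
    (@outcome R d)
    (cond_exp (cube_law v) (fun z => (covariate z, treatment z)) (@outcome R d)).
Proof.
apply: (@cond_exp_version _ _ _ _ _ _ _ _ (success_fun v)).
apply/is_cond_exp_mixture.
- exact: measurable_covariate_treatment.
- exact: measurable_outcome.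
split => [|D mD].
  exact: (measurableT_comp (measurable_fun_nat (fun a =>
    if insub a.-1 is Some i then success delta v i else 0)) measurable_snd).
rewrite !sum_cells; apply: eq_bigr => i _.
rewrite /= /success_fun /= valK /cell_weight /=; ring.
Qed.

(** Again every version agrees at (origin, i + 1), a point of mass 1/k > 0;
testing the defining identity on A = i + 1 isolates it. *)
Lemma mu_cube v (i : 'I_k) : mu (cube_law v) i.+1 origin = success delta v i.
Proof.
have mD : measurable ([set: d.-tuple (measurableTypeR R)] `*` [set i.+1]).
  exact: measurableX.
have /is_cond_exp_mixture[||_ /(_ _ mD)] := cond_exp_mu v.
- exact: measurable_covariate_treatment.
- exact: measurable_outcome.
have indE z : \1_([set: d.-tuple (measurableTypeR R)] `*` [set i.+1])
    (origin, (z : 'I_k * bool).1.+1) = (z.1.+1 == i.+1)%:R :> R.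
  rewrite indicE; congr (nat_of_bool _)%:R; apply/idP/eqP.
    by rewrite inE => -[].
  by move=> zi; rewrite inE.
set g := cond_exp _ _ _.
rewrite (eq_bigr (fun z => (cell_pmf v z)%:num *
    ((z.1.+1 == i.+1)%:R * g (origin, i.+1)))) => [|z _]; last first.
  by rewrite /= indE; case: eqP => [zi|_]; [rewrite -zi|rewrite !mul0r].
rewrite [in RHS](eq_bigr (fun z => (cell_pmf v z)%:num *
    ((z.1.+1 == i.+1)%:R * z.2%:R))) => [|z _]; last by rewrite /= indE.
rewrite (sum_level v i (fun=> g _)) (sum_level v i (fun b => b%:R)).
rewrite mulr1 mulr0 addr0 -mulrDl addrC subrK mul1r.
by apply: mulfI; rewrite invr_eq0 pnatr_eq0 -lt0n.
Qed.

Lemma psi_cube v (i : 'I_k) : psi (cube_law v) i.+1 = success delta v i.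
Proof.
have [mg _ _] := cond_exp_mu v.
have mmu : measurable_fun setT (mu (cube_law v) i.+1).
  exact: (measurableT_comp mg (@pair2_measurable _ _ _ _ i.+1)).
rewrite /psi unlock [X in fine X]integral_mixture//; last first.
  exact: (measurableT_comp mmu (@measurable_covariate R d)).
rewrite /= -[RHS](mu_cube v) -[RHS](mean_cst v).
by apply: eq_bigr => z _; rewrite indicT mul1r.
Qed.

Lemma varpi_cube v (i : 'I_k) : varpi (cube_law v) i.+1 = k%:R^-1.
Proof.
rewrite /varpi fine_mixture.
rewrite (eq_bigr (fun z => (cell_pmf v z)%:num *
    ((z.1.+1 == i.+1)%:R * 1))) => [|z _]; last first.
  rewrite mulr1 indicE; congr (_ * (nat_of_bool _)%:R); apply/idP/eqP.
    by rewrite inE.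
  by move=> zi; rewrite inE.
by rewrite (sum_level v i (fun=> 1)) !mulr1 addrC subrK mulr1.
Qed.

Lemma cube_law_model v (C' : R) : C' <= 1 -> model_class d k C' (cube_law v).
Proof.
move=> C'1; split.
- apply: ae_mixture => [|z]; last by rewrite /atom /treatment /= ltn_ord.
  rewrite -[X in measurable X]setTI.
  exact: (@measurable_treatment R d measurableT [set a | (1 <= a <= k)%N]).
- apply: ae_mixture => [|[i []]]; [|by right|by left].
  rewrite (_ : [set t | _] = (@outcome R d) @^-1` ([set 0] `|` [set 1]))//.
  rewrite -[X in measurable X]setTI; apply: measurable_outcome => //.
  exact: measurableU.
- move=> [//|a] /= ak.
  have [mg _ _] := cond_exp_propensity v (Ordinal ak).
  apply: ae_mixture => [|z]; last first.
    rewrite (propensity_cube v (Ordinal ak)) ler_piMl// invr_ge0//.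
  rewrite (_ : [set t | _] = (propensity (cube_law v) a.+1 \o @covariate R d)
    @^-1` `[C' / k%:R, +oo[); last first.
    by apply/seteqP; split => t /=; rewrite in_itv /= andbT.
  rewrite -[X in measurable X]setTI.
  exact: (measurableT_comp mg (@measurable_covariate R d)).
- move=> B D mB mD; rewrite !cube_lawE.
  have -> : (\sum_z ((cell_pmf v z)%:num)%:E *
      \d_(atom z) [set z : obs R d | B (covariate z)] = \d_origin B)%E.
    transitivity (\sum_z ((cell_pmf v z)%:num)%:E * \d_origin B)%E; first by [].
    rewrite -ge0_sume_distrl; last by move=> z _; rewrite lee_fin.
    by rewrite sumEFin sum_cell_pmf mul1e.
  rewrite ge0_sume_distrr; last by move=> z _; rewrite mule_ge0// lee_fin.
  apply: eq_bigr => z _; rewrite muleCA; congr (_ * _)%E.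
  rewrite !diracE -EFinM -natrM mulnb; congr (nat_of_bool _)%:R%:E.
  by apply/idP/andP; rewrite !inE.
Qed.

End hypercube_law.

(** * The minimax bound *)

Lemma risk_cube (R : realType) (d k n : nat) (delta : R) (k_gt0 : (0 < k)%N)
    (delta_ge0 : 0 <= delta) (delta_le : delta <= 2^-1)
    (v : {ffun 'I_k -> bool})
    (psihat : n.-tuple (obs R d) -> k.-tuple (measurableTypeR R)) :
  measurable_fun setT psihat ->
  risk psihat (cube_law d k_gt0 delta_ge0 delta_le v) =
  (\sum_(s : n.-tuple ('I_k * bool)) sample_weight delta v s *
     \sum_i k%:R^-1 *
       (tnth (psihat [tuple of map (@atom R d k) s]) i - success delta v i) ^+ 2)%:E.
Proof.
move=> mpsihat; rewrite /risk unlock.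
have mloss : measurable_fun setT (fun s =>
    \sum_(i < k) varpi (cube_law d k_gt0 delta_ge0 delta_le v) i.+1 *
    (tnth (psihat s) i - psi (cube_law d k_gt0 delta_ge0 delta_le v) i.+1) ^+ 2).
  apply: measurable_sum => i; apply: measurable_funM => //.
  apply: measurable_funX; apply: measurable_funB => //.
  exact: (measurableT_comp (measurable_tnth i) mpsihat).
rewrite ge0_integral_iid_mixture//; last 2 first.
- exact/measurable_EFinP.
- move=> s; rewrite lee_fin; apply: sumr_ge0 => i _.
  by rewrite varpi_cube mulr_ge0 ?invr_ge0// sqr_ge0.
under eq_bigr do rewrite -EFinM.
rewrite sumEFin; congr EFin; apply: eq_bigr => s _; congr (_ * _).
by apply: eq_bigr => i _; rewrite varpi_cube psi_cube.
Qed.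

Theorem proposition1 (R : realType) :
  exists C : R, 0 < C /\
    forall (d k n : nat) (C' : R),
      (32 <= k)%N -> (0 < n)%N -> 0 < C' -> C' <= 1 ->
      ((C * Num.min (k%:R / n%:R) 1)%:E <= minimax_risk d k n C')%E.
Proof.
exists (32^-1); split=> [|d k n C' k32 n_gt0 _ C'1]; first by rewrite invr_gt0.
have k_gt0 : (0 < k)%N by exact: leq_trans k32.
have kR : 0 < k%:R :> R by rewrite ltr0n.
have nR : 0 < n%:R :> R by rewrite ltr0n.
set m := Num.min _ _.
have m_ge0 : 0 <= m by rewrite le_min divr_ge0/=.
have m_le1 : m <= 1 by rewrite ge_min lexx orbT.
have m_lekn : m <= k%:R / n%:R by rewrite ge_min lexx.
(* Up to a constant factor, the largest signal that keeps delta <= 1/2 and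
   4 n delta^2 / k <= 1/2. *)
pose delta := Num.sqrt (m / 8).
have delta2 : delta ^+ 2 = m / 8 by rewrite sqr_sqrtr// divr_ge0.
have delta_ge0 : 0 <= delta by exact: sqrtr_ge0.
have delta_le : delta <= 2^-1.
  by rewrite -(ler_pXn2r (n := 2))// ?nnegrE ?invr_ge0// delta2; lra.
have small_signal : n%:R * (4 * delta ^+ 2 / k%:R) <= 2^-1.
  rewrite delta2 mulrA ler_pdivrMr//.
  by move: m_lekn; rewrite ler_pdivlMr// => h; lra.
apply: le_ereal_inf_tmp => _ [psihat mpsihat <-].
have [v hv] := assouad_risk k_gt0 delta_ge0 delta_le small_signal
  (fun s i => tnth (psihat [tuple of map (@atom R d k) s]) i).
apply: (@le_trans _ _ (risk psihat (cube_law d k_gt0 delta_ge0 delta_le v))).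
  rewrite risk_cube// lee_fin; apply: le_trans hv; rewrite delta2; lra.
apply: ereal_sup_ubound; exists (cube_law d k_gt0 delta_ge0 delta_le v) => //.
exact: cube_law_model.
Qed.
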